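(* Let $K$ be a field of characteristic zero. The Gauss algebra $\mathbb{G}(A)$ of a Borel-fixed algebra $A$ over $K$ is a Borel-fixed algebra.
   Context: Borel sets: a set $G=\{g_1,\ldots,g_n\}$ of monomials of the same degree in the polynomial ring $S=K[x_1,\ldots,x_d]$ is called a Borel set if the monomial ideal generated by $G$ is fixed under the action of all linear automorphisms $\varphi:S\to S$ defined by nonsingular upper triangular matrices (so that $x_i$ is sent to a $K$-linear combination of $x_1,\ldots,x_i$). Since $\mathrm{char}(K)=0$, this is equivalent to: for every $u\in G$ and all $i<j$ such that $x_j$ divides $u$, one has $x_i(u/x_j)\in G$. Borel-fixed algebra: let $G=\{g_1,\ldots,g_n\}\subset K[x_1,\ldots,x_d]$ be a Borel set. Then the $K$-algebra $A=K[g_1,\ldots,g_n]$ is called a Borel-fixed algebra if $\dim(A)=d$. Log-matrix: for monomials $g_i=x_1^{a_{1i}}\cdots x_d^{a_{di}}$, $i=1,\ldots,n$, $\mathrm{Log}(g_1,\ldots,g_n)=(a_{ij})$ is the matrix whose columns are the exponent vectors of the $g_i$. Gauss algebra: if $A=K[g_1,\ldots,g_n]\subseteq S=K[x_1,\ldots,x_d]$ is generated by non-constant homogeneous polynomials of the same degree and $\dim A=d$, then the Gauss algebra $\mathbb{G}(A)$ is the $K$-subalgebra of $S$ generated by the $d\times d$ minors of the Jacobian matrix of $g_1,\ldots,g_n$ (it does not depend on the choice of the homogeneous generators of $A$). If the $g_i$ are monomials of degree $r$, then $\mathbb{G}(A)$ is generated by the monomials $(g_{i_1}\cdots g_{i_d})/(x_1\cdots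 x_d)$ with $\det(\mathrm{Log}(g_{i_1},\ldots,g_{i_d}))\neq 0$, all of degree $(r-1)d$.
   Formalization: The Gauss algebra is shown to be Borel-fixed in K[x_1,…,x_e] for some e ≤ d, with dimension e; with the number of variables fixed at d the claim fails, e.g. A = K[x_1^2, x_1x_2] has Gauss algebra K[x_1^2], of dimension 1. *)

(* Defs.v *)
From mathcomp Require Import all_boot all_algebra.
From mathcomp Require Import mpoly.

Set Implicit Arguments.
Unset Strict Implicit.
Unset Printing Implicit Defensive.

Import GRing.Theory.
Local Open Scope ring_scope.

(* Subsets of K[x_1, ..., x_d] are Prop-valued predicates; x_1, ..., x_d are
   the variables 'X_i with i : 'I_d, numbered from 0. *)

Section Defs.

Variable K : fieldType.

(* The K-subalgebra K[s_1, ..., s_n]: all polynomial expressions in s. *)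
Definition generated_algebra d (s : seq {mpoly K[d]}) (f : {mpoly K[d]}) : Prop :=
  exists P : {mpoly K[size s]}, f = P \mPo (in_tuple s).

Definition generated_ideal d (s : seq {mpoly K[d]}) (f : {mpoly K[d]}) : Prop :=
  exists c : 'I_(size s) -> {mpoly K[d]},
    f = \sum_(i < size s) c i * tnth (in_tuple s) i.

(* Krull dimension of a subring A of K[x_1, ..., x_d]. *)

Definition prime_ideal_of d (A P : {mpoly K[d]} -> Prop) : Prop :=
  [/\ (forall f, P f -> A f),
      P 0 /\ (forall f g, P f -> P g -> P (f + g)),
      (forall a f, A a -> P f -> P (a * f)),
      ~ P 1
    & (forall f g, A f -> A g -> P (f * g) -> P f \/ P g)].

(* A chain P_0 < P_1 < ... < P_k of prime ideals of A. *)
Definition has_prime_chain d (A : {mpoly K[d]} -> Prop) (k : nat) : Prop :=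
  exists P : nat -> {mpoly K[d]} -> Prop,
    (forall i, (i <= k)%N -> prime_ideal_of A (P i)) /\
    (forall i, (i < k)%N ->
       (forall f, P i f -> P i.+1 f) /\ (exists f, P i.+1 f /\ ~ P i f)).

Definition krull_dim d (A : {mpoly K[d]} -> Prop) (k : nat) : Prop :=
  has_prime_chain A k /\ (forall l, has_prime_chain A l -> (l <= k)%N).

(* The substitution x_j |-> \sum_i M i j x_i; for M upper triangular, x_j is
   sent to a combination of x_1, ..., x_j. *)
Definition linear_subst d (M : 'M[K]_d) (f : {mpoly K[d]}) : {mpoly K[d]} :=
  f \mPo [tuple \sum_(i < d) M i j *: 'X_i | j < d].

(* is_trig_mx is lower triangularity, whence the transpose. *)
Definition upper_triangular d (M : 'M[K]_d) : bool := is_trig_mx M^T.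

(* A monomial is represented by its exponent vector in 'X_{1..d}. *)
Definition monomials d (G : seq 'X_{1..d}) : seq {mpoly K[d]} :=
  [seq 'X_[m] | m <- G].

Definition borel_set d (G : seq 'X_{1..d}) : Prop :=
  (exists r : nat, forall m, m \in G -> mdeg m = r) /\
  (forall M : 'M[K]_d, M \in unitmx -> upper_triangular M ->
     forall f, generated_ideal (monomials G) f <->
       exists h, generated_ideal (monomials G) h /\ f = linear_subst M h).

(* The inclusion of K[x_1, ..., x_e] in K[x_1, ..., x_d]. *)
Definition mpoly_incl e d (le_ed : (e <= d)%N) (f : {mpoly K[e]}) : {mpoly K[d]} :=
  f \mPo [tuple 'X_(widen_ord le_ed i) | i < e].

(* A = K[G] for a Borel set G of monomials of K[x_1, ..., x_e] such that
   dim A = e. The ring K[x_1, ..., x_e] is not part of the data: it may be a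
   proper subring of the ambient K[x_1, ..., x_d]. One cannot insist on e = d
   for Gauss algebras: that of K[x_1^2, x_1 x_2] is K[x_1^2]. *)
Definition borel_fixed_algebra d (A : {mpoly K[d]} -> Prop) : Prop :=
  exists (e : nat) (le_ed : (e <= d)%N) (G : seq 'X_{1..e}),
    [/\ borel_set G,
        (forall f, A f <->
           generated_algebra [seq mpoly_incl le_ed m | m <- monomials G] f)
      & krull_dim A e].

Definition jacobian d (s : seq {mpoly K[d]}) : 'M[{mpoly K[d]}]_(d, size s) :=
  \matrix_(i < d, j < size s) (tnth (in_tuple s) j)^`M(i).

Definition increasing d n (c : {ffun 'I_d -> 'I_n}) : bool :=
  [forall i : 'I_d, forall j : 'I_d, (i < j)%N ==> (c i < c j)%N].

(* The d x d minors: c selects the columns, in increasing order. *)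
Definition maximal_minors d n (J : 'M[{mpoly K[d]}]_(d, n)) : seq {mpoly K[d]} :=
  [seq \det (colsub c J) | c : {ffun 'I_d -> 'I_n} <-
     enum [pred c : {ffun 'I_d -> 'I_n} | increasing c]].

(* B is the Gauss algebra of A, computed from some system g of non-constant
   homogeneous generators of A of the same degree r. *)
Definition is_gauss_algebra d (A B : {mpoly K[d]} -> Prop) : Prop :=
  exists (r : nat) (g : seq {mpoly K[d]}),
    [/\ (0 < r)%N,
        (forall f, f \in g -> f != 0 /\ f \is r.-homog),
        (forall f, A f <-> generated_algebra g f),
        krull_dim A d
      & (forall f, B f <-> generated_algebra (maximal_minors (jacobian g)) f)].

End Defs.

(* Main.v *)
Require Import Defs.
From mathcomp Require Import all_boot all_algebra.
From mathcomp Require Import all_fingroup zify.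
From mathcomp Require Import mpoly.

(** In characteristic 0 a Borel set is the same as a strongly stable set of
    monomials of one degree. The linear span of the maximal minors depends only
    on the span of the generators (up to constants), so the Gauss algebra of
    [K[G]] is generated by the monomials [u_1 ... u_d / (x_1 ... x_d)] with
    [u_k \in G] and [det (Log u) <> 0]. To move such a monomial from [x_j] to
    [x_i], replace one factor [u_k] by [x_i u_k / x_j]; by Cramer's rule this
    multiplies the determinant by [1 + w_k], where [Log u * w = e_i - e_j], and
    [w_k = -1] for every [k] with [x_j | u_k] would force [x_j] to occur exactly
    once in [u_1 ... u_d].

    A strongly stable set whose last occurring variable is [x_e] contains, for
    each [j <= e], a monomial in [x_1, ..., x_j] divisible by [x_j]; hence the
    contractions of the ideals [(x_{e-i+1}, ..., x_e)] form a chain of length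
    [e]. Conversely, elements [f_i] of [P_{i+1}] outside [P_i] along a chain of
    primes are algebraically independent, so there are at most [e] of them. *)

Set Implicit Arguments.
Unset Strict Implicit.
Unset Printing Implicit Defensive.

Import GRing.Theory.
Local Open Scope ring_scope.

Lemma comp_mpolyA (R : comNzRingType) k l n (s : l.-tuple {mpoly R[k]})
    (t : k.-tuple {mpoly R[n]}) (f : {mpoly R[l]}) :
  (f \mPo s) \mPo t = f \mPo [tuple tnth s i \mPo t | i < l].
Proof.
rewrite (comp_mpolyEX f) [RHS]comp_mpolyEX linear_sum.
apply: eq_bigr => m _; rewrite linearZ /= !comp_mpolyX rmorph_prod; congr (_ *: _).
by apply: eq_bigr => i _; rewrite rmorphXn tnth_mktuple.
Qed.

(** * Subalgebras generated by a sequence of polynomials *)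

Section Subalgebra.

Variable K : fieldType.

Definition subalgebra d (A : {mpoly K[d]} -> Prop) : Prop :=
  [/\ (forall c, A c%:MP), (forall f g, A f -> A g -> A (f + g))
    & (forall f g, A f -> A g -> A (f * g))].

Section Closure.

Variables (d : nat) (A : {mpoly K[d]} -> Prop).
Hypothesis sA : subalgebra A.

Lemma subalgebra1 : A 1.
Proof. by have [Ac _ _] := sA; rewrite -mpolyC1. Qed.

Lemma subalgebraZ c f : A f -> A (c *: f).
Proof. by have [Ac _ AM] := sA => Af; rewrite -mul_mpolyC; apply: AM. Qed.

Lemma subalgebra_sum (I : Type) (r : seq I) (P : pred I) (F : I -> {mpoly K[d]}) :
  (forall i, P i -> A (F i)) -> A (\sum_(i <- r | P i) F i).
Proof.
have [Ac AD _] := sA => AF; elim/big_rec: _ => [|i x Pi]; first by rewrite -mpolyC0.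
by apply: AD; apply: AF.
Qed.

Lemma subalgebra_prod (I : Type) (r : seq I) (P : pred I) (F : I -> {mpoly K[d]}) :
  (forall i, P i -> A (F i)) -> A (\prod_(i <- r | P i) F i).
Proof.
have [_ _ AM] := sA => AF; elim/big_rec: _ => [|i x Pi]; first exact: subalgebra1.
by apply: AM; apply: AF.
Qed.

Lemma subalgebraX f k : A f -> A (f ^+ k).
Proof.
by move=> Af; rewrite -[k]card_ord -prodr_const; apply: subalgebra_prod.
Qed.

End Closure.

Lemma generated_subalgebra d (s : seq {mpoly K[d]}) :
  subalgebra (generated_algebra s).
Proof.
split=> [c|_ _ [P ->] [Q ->]|_ _ [P ->] [Q ->]].
- by exists c%:MP; rewrite comp_mpolyC.
- by exists (P + Q); rewrite comp_mpolyD.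
- by exists (P * Q); rewrite rmorphM.
Qed.

Lemma mem_generated_algebra d (s : seq {mpoly K[d]}) f :
  f \in s -> generated_algebra s f.
Proof.
rewrite -index_mem => lt_fs; exists 'X_(Ordinal lt_fs).
by rewrite comp_mpolyXU /= nth_index // -index_mem.
Qed.

Lemma generated_algebra_min d (s : seq {mpoly K[d]}) (A : {mpoly K[d]} -> Prop) :
  subalgebra A -> (forall f, f \in s -> A f) ->
  forall f, generated_algebra s f -> A f.
Proof.
move=> sA As _ [P ->]; rewrite comp_mpolyEX; apply: subalgebra_sum => // m _.
apply: subalgebraZ => //; rewrite comp_mpolyX; apply: subalgebra_prod => // i _.
by apply: subalgebraX => //; apply: As; apply: mem_tnth.
Qed.

Lemma eq_generated_algebra d (s t : seq {mpoly K[d]}) :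
  (forall f, f \in s -> generated_algebra t f) ->
  (forall f, f \in t -> generated_algebra s f) ->
  forall f, generated_algebra s f <-> generated_algebra t f.
Proof.
move=> st ts f; split; apply: generated_algebra_min => //; exact: generated_subalgebra.
Qed.

End Subalgebra.

(** * Krull dimension *)

Section Dependence.

Variable K : fieldType.

(** All exponents occurring in the [h t] are below [D], so the coefficients fit in a matrix with
    [D ^ n] columns and more rows than that; a nonzero vector of its left kernel gives [c]. *)
Lemma linear_dependence (T : finType) n D (h : T -> {mpoly K[n]}) :
  (forall t, (msize (h t) <= D)%N) -> (D ^ n < #|T|)%N ->
  exists c : T -> K, (exists t, c t != 0) /\ \sum_t c t *: h t = 0.
Proof.
move=> hD ltDT; pose E := {ffun 'I_n -> 'I_D}.
pose M := \matrix_(i < #|T|, j < #|E|)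
   (h (enum_val i))@_[multinom (enum_val j x : nat) | x < n].
have kerM0 : kermx M != 0.
  rewrite -mxrank_eq0 mxrank_ker subn_eq0 -ltnNge.
  apply: leq_ltn_trans (rank_leq_col _) _.
  by rewrite card_ffun !card_ord.
have /rowV0Pn[v /sub_kermxP vM v0] := kerM0.
exists (fun t => v 0 (enum_rank t)); split.
  have [j vj] : exists j, v 0 j != 0.
    apply/existsP; apply: contraR v0 => /existsPn v0.
    by apply/eqP/rowP=> j; rewrite mxE; apply/eqP; rewrite -[_ == _]negbK v0.
  by exists (enum_val j); rewrite enum_valK.
apply/mpolyP=> m; rewrite mcoeff0 raddf_sum /=.
have [/forallP mD|/forallPn[i]] := boolP [forall i, m i < D]%N; last first.
  rewrite -leqNgt => leDm; apply: big1 => t _.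
  rewrite mcoeffZ; apply/eqP; rewrite mulf_eq0 mcoeff_eq0 msize_mdeg_ge ?orbT //.
  by rewrite (leq_trans (hD t)) // (leq_trans leDm) // mdegE (bigD1 i) //= leq_addr.
pose e : E := [ffun i => Ordinal (mD i)].
have /rowP/(_ (enum_rank e)) := vM; rewrite !mxE => vMe.
rewrite -[RHS]vMe [RHS](reindex (@enum_rank T)) /=; last first.
  by apply: onW_bij; exists enum_val; [exact: enum_rankK | exact: enum_valK].
apply: eq_bigr => t _; rewrite mcoeffZ mxE enum_rankK; congr (_ * mcoeff _ _).
  by apply/mnmP=> x; rewrite mnmE ffunE.
by rewrite enum_rankK.
Qed.

(** Exponent vectors with entries below [N], as nested pairs so that an induction on [k] can split
    off the first exponent. *)
Fixpoint digits (N k : nat) : finType :=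
  if k is k'.+1 then ('I_N * digits N k')%type else unit.

Lemma card_digits N k : #|digits N k| = (N ^ k)%N.
Proof. by elim: k => [|k IH] /=; rewrite ?card_unit // card_prod card_ord IH expnS. Qed.

Fixpoint power_product (R : comNzRingType) N k (f : nat -> R) : digits N k -> R :=
  if k is k'.+1 then fun t => f 0%N ^+ t.1 * power_product (fun i => f i.+1) t.2
  else fun=> 1.

Lemma rmorph_power_product (R S : comNzRingType) (phi : {rmorphism R -> S}) N k
    (f : nat -> R) (t : digits N k) :
  phi (power_product f t) = power_product (phi \o f) t.
Proof. by elim: k f t => [|k IH] f t /=; rewrite ?rmorph1 // rmorphM rmorphXn IH. Qed.

(** Since [msize] is the degree plus one on nonzero polynomials, [a] and [b] are degree bounds, and
    they add. *)
Lemma msize_mulS n (p q : {mpoly K[n]}) a b :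
  (msize p <= a.+1 -> msize q <= b.+1 -> msize (p * q) <= (a + b).+1)%N.
Proof.
have [->|p0] := eqVneq p 0; first by rewrite mul0r mmeasure0.
have [->|q0] := eqVneq q 0; first by rewrite mulr0 mmeasure0.
move=> pa qb; rewrite msizeM // -(leq_add2r 1) !addn1 prednK.
  by rewrite -addnS -addSn leq_add.
by rewrite addn_gt0 lt0n msize_poly_eq0 p0.
Qed.

Lemma msize_expS n (p : {mpoly K[n]}) a k :
  (msize p <= a.+1 -> msize (p ^+ k) <= (a * k).+1)%N.
Proof.
move=> pa; elim: k => [|k IH]; first by rewrite expr0 msize1.
by rewrite exprS mulnS; apply: msize_mulS.
Qed.

Lemma msize_power_product n N k a (f : nat -> {mpoly K[n]}) (t : digits N k) :
  (forall i, (i < k)%N -> msize (f i) <= a.+1)%N ->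
  (msize (power_product f t) <= (k * (a * N)).+1)%N.
Proof.
elim: k f t => [|k IH] f t fa /=; first by rewrite msize1.
rewrite mulSn; apply: msize_mulS; last by apply: IH => i; apply: (fa i.+1).
apply: leq_trans (msize_expS _ (fa 0%N isT)) _.
by rewrite ltnS leq_mul2l (ltnW (ltn_ord _)) orbT.
Qed.

End Dependence.

(** * Chains of prime ideals and algebraic independence *)

Section KrullDimension.

Variable K : fieldType.

Lemma prime_ideal_expM d (A P : {mpoly K[d]} -> Prop) f g k :
  subalgebra A -> prime_ideal_of A P -> A f -> A g -> ~ P f ->
  P (f ^+ k * g) -> P g.
Proof.
move=> sA [_ _ _ _ primeP] Af Ag nPf; elim: k => [|k IH]; first by rewrite mul1r.
rewrite exprS -mulrA => /primeP[] //.
by have [_ _ AM] := sA; apply: AM => //; apply: subalgebraX.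
Qed.

Lemma subalgebra_power_product d (A : {mpoly K[d]} -> Prop) N k
    (f : nat -> {mpoly K[d]}) (t : digits N k) :
  subalgebra A -> (forall i, (i < k)%N -> A (f i)) -> A (power_product f t).
Proof.
move=> sA; elim: k f t => [|k IH] f t Af /=; first exact: subalgebra1.
have [_ _ AM] := sA; apply: AM; first by apply: subalgebraX => //; apply: Af.
by apply: IH => i; apply: (Af i.+1).
Qed.

(* Sort the sum by the exponent of f 0. If m is the least exponent that occurs,
   the sum is f 0 ^+ m * (S m + f 0 * R), so S m + f 0 * R is in P 0 and S m is in
   P 1, where induction applies to S m. *)
Lemma prime_chain_independent d (A : {mpoly K[d]} -> Prop) N k
    (f : nat -> {mpoly K[d]}) (P : nat -> {mpoly K[d]} -> Prop) :
  subalgebra A ->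
  (forall i, (i <= k)%N -> prime_ideal_of A (P i)) ->
  (forall i, (i < k)%N ->
     [/\ forall g, P i g -> P i.+1 g, P i.+1 (f i) & ~ P i (f i)]) ->
  forall c : digits N k -> K,
    P 0%N (\sum_t c t *: power_product f t) -> forall t, c t = 0.
Proof.
move=> sA; have [Ac AD AM] := sA.
elim: k f P => [|k IH] f P primeP chainP c.
  have [_ _ PM P1 _] := primeP 0%N isT.
  rewrite (big_pred1 tt); last by case.
  move=> /= Pc [] ; apply/eqP/negP=> /negP c0; apply: P1.
  rewrite -[1]mulr1 -(scale1r (1 * 1)) -(mulVf c0) mul1r -scalerA -mul_mpolyC.
  exact: PM.
have [P01 P1f nP0f] := chainP 0%N isT.
have [P1A [_ P1D] P1M _ _] := primeP 1%N isT.
have Af i : (i < k.+1)%N -> A (f i).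
  move=> lt_ik; have [_ Pf _] := chainP i lt_ik.
  by have [PA _ _ _ _] := primeP i.+1 lt_ik; apply: PA.
have Af0 := Af 0%N isT.
have App (t : digits N k) : A (power_product (fun i => f i.+1) t).
  by apply: subalgebra_power_product => // i; apply: (Af i.+1).
pose S m := \sum_t c (m, t) *: power_product (fun i => f i.+1) t.
have AS m : A (S m) by apply: subalgebra_sum => // t _; apply: subalgebraZ.
have -> : \sum_t c t *: @power_product _ N k.+1 f t = \sum_(m < N) f 0%N ^+ m * S m.
  rewrite /S /=; under [RHS]eq_bigr do rewrite mulr_sumr.
  rewrite pair_bigA /=; apply: eq_bigr => -[m t] _ /=.
  by rewrite scalerAr.
move=> P0sum [m t]; move: t.
(* Strong induction on [m]: the coefficients at smaller exponents of [f 0] already vanish, so [m] is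
   the least exponent that can still occur. *)
have [l] := ubnP (m : nat); elim: l m => // l IHl m /ltnSE le_ml.
have S0 (m' : 'I_N) : (m' < m)%N -> S m' = 0.
  move=> lt_m'm; apply: big1 => t _.
  by rewrite (IHl m') ?scale0r // (leq_trans lt_m'm).
pose R := \sum_(m' < N | (m < m')%N) f 0%N ^+ (m' - m.+1) * S m'.
have AR : A R by apply: subalgebra_sum => // i _; apply: AM => //; apply: subalgebraX.
have sumE : \sum_(m' < N) f 0%N ^+ m' * S m' = f 0%N ^+ m * (S m + f 0%N * R).
  rewrite (bigD1 m) //= mulrDr; congr (_ + _).
  rewrite (bigID (fun m' : 'I_N => (m < m')%N)) /= [X in _ + X]big1 ?addr0; last first.
    move=> i /andP[neq_im]; rewrite -leqNgt leq_eqVlt (inj_eq val_inj) (negPf neq_im) /=.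
    by move=> lt_im; rewrite S0 // mulr0.
  rewrite /R !mulr_sumr; apply: eq_big => [i|i /andP[_ lt_mi]].
    by rewrite andb_idl // => lt_mi; rewrite -val_eqE neq_ltn lt_mi orbT.
  by rewrite !mulrA -exprSr -exprD subnKC.
have P1S : P 1%N (S m).
  have: P 1%N (S m + f 0%N * R).
    apply/P01/(prime_ideal_expM sA (primeP 0%N isT) Af0 _ nP0f (k := m)).
      2: by rewrite -sumE.
    by apply: AD => //; apply: AM.
  move=> PSR; have -> : S m = (S m + f 0%N * R) + (- 1)%:MP * (R * f 0%N).
    by rewrite mpolyCN mulN1r mulrC addrK.
  by apply: P1D => //; apply: (P1M) => //; apply: P1M.
apply: (IH (fun i => f i.+1) (fun i => P i.+1) _ _ (fun t => c (m, t))) => // i.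
  exact: (primeP i.+1).
exact: (chainP i.+1).
Qed.


(** A longer chain would yield [n.+1] elements [phi (h i)] without polynomial relation modulo [P 0],
    while a dimension count gives a relation between any [n.+1] polynomials in [n] variables. With
    [phi] the inclusion of a smaller polynomial ring, the bound is the number of variables of that
    ring. *)
Lemma prime_chain_length d n (phi : {lrmorphism {mpoly K[n]} -> {mpoly K[d]}})
    (A : {mpoly K[d]} -> Prop) l :
  subalgebra A -> (forall f, A f -> exists h, f = phi h) ->
  has_prime_chain A l -> (l <= n)%N.
Proof.
move=> sA Aphi [P [primeP chainP]]; rewrite leqNgt; apply/negP => lt_nl.
have /fin_all_exists[h hP] (i : 'I_n.+1) :
    exists h, P i.+1 (phi h) /\ ~ P i (phi h).
  have lt_il : (i < l)%N := leq_trans (ltn_ord i) lt_nl.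
  have [_ [f [Pf nPf]]] := chainP i lt_il.
  have [PA _ _ _ _] := primeP i.+1 lt_il.
  by have [h fE] := Aphi f (PA f Pf); exists h; rewrite -fE.
pose F i := h (inord i).
pose a := (\max_(i < n.+1) msize (h i))%N.
have Fa i : (msize (F i) <= a.+1)%N by rewrite ltnW // ltnS leq_bigmax.
(* Power products with exponents below [N] have degree less than [b * N], hence lie in a space of
   dimension [(b * N) ^ n]; the choice [N > b ^ n] makes their number [N ^ n.+1] larger. *)
pose b := (n.+1 * a).+1; pose N := (b ^ n).+1.
have [t||c [[t c0] sum0]] := @linear_dependence K (digits N n.+1) n (b * N)
    (fun t => power_product F t).
- apply: leq_trans (msize_power_product t (fun i _ => Fa i)) _.
  by rewrite [(b * N)%N]mulSn -mulnA -[leqLHS]add1n leq_add2r.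
- by rewrite card_digits expnMn expnS ltn_pmul2r ?expn_gt0.
apply/negP: c0; rewrite negbK; apply/eqP.
apply: (@prime_chain_independent d A N n.+1 (phi \o F) P) => //.
- by move=> i le_in; apply: primeP; apply: leq_trans lt_nl.
- move=> i lt_in; have [P_sub _] := chainP i (leq_trans lt_in lt_nl).
  by have [Pi nPi] := hP (inord i); rewrite inordK in Pi nPi.
have [_ [P0 _] _ _ _] := primeP 0%N isT.
rewrite -[X in P _ X](_ : phi (\sum_t c t *: power_product F t) = _).
  by rewrite sum0 rmorph0.
by rewrite linear_sum; apply: eq_bigr => u _; rewrite linearZ -rmorph_power_product.
Qed.

(** * Dimension of the algebra generated by a strongly stable set *)

Definition strongly_stable d (G : seq 'X_{1..d}) : Prop :=
  forall u (i j : 'I_d), u \in G -> (i < j)%N -> (0 < u j)%N ->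
    (u - U_(j) + U_(i))%MM \in G.

(** Moving a factor from a variable after [j] to [j] stays in [G] and lowers [s u], the total
    exponent after [j]. Throughout, [s u] or [u j] is positive, so [u j] is positive once [s u]
    reaches 0. *)
Lemma strongly_stable_leading d (G : seq 'X_{1..d}) (k : nat) :
  strongly_stable G ->
  (exists2 u, u \in G & exists2 i : 'I_d, (k <= i)%N & (0 < u i)%N) ->
  forall j : 'I_d, nat_of_ord j = k ->
    exists2 w, w \in G & (0 < w j)%N /\ forall l : 'I_d, (j < l)%N -> w l = 0%N.
Proof.
move=> stG [u + [i le_ki u_i]] j jk; pose s u := (\sum_(l < d | j < l) u l)%N.
have {le_ki u_i}: (0 < s u)%N || (0 < u j)%N.
  move: le_ki; rewrite -jk leq_eqVlt (inj_eq val_inj) => /predU1P[->|lt_ji].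
    by rewrite u_i orbT.
  by rewrite /s (bigD1 i) //= addn_gt0 u_i.
have [n] := ubnP (s u); elim: n u => // n IH u lt_un u_pos uG.
have [s0|] := posnP (s u).
  rewrite s0 in u_pos; exists u => //; split=> // l lt_jl.
  by move/eqP: s0; rewrite sum_nat_eq0 => /forallP/(_ l)/implyP/(_ lt_jl)/eqP.
rewrite lt0n sum_nat_eq0 => /forallPn[l]; rewrite negb_imply -lt0n => /andP[lt_jl ul].
apply: (IH (u - U_(l) + U_(j))%MM); last exact: stG.
- apply: leq_trans (ltnSE lt_un); rewrite /s (bigD1 l) //= [X in (_ < X)%N](bigD1 l) //=.
  rewrite -addSn leq_add //.
    by rewrite mnmDE mnmBE !mnm1E eqxx -val_eqE (ltn_eqF lt_jl) addn0 subn1 prednK.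
  apply: leq_sum => x /andP[lt_jx neq_xl]; rewrite mnmDE mnmBE !mnm1E.
  by rewrite -[j == x]val_eqE (ltn_eqF lt_jx) addn0 leq_subr.
by rewrite mnmDE [(U_(_) j)%MM]mnm1E eqxx addn1 orbT.
Qed.

(** The kernel is the ideal generated by the variables of index at least [k], so membership in its
    contraction to a subalgebra becomes an equation, and primality follows from the target being a
    domain. *)
Definition truncate_vars d k (f : {mpoly K[d]}) : {mpoly K[d]} :=
  f \mPo [tuple if (i < k)%N then 'X_i else 0 | i < d].

Lemma truncate_varsX d k (i : 'I_d) :
  truncate_vars k ('X_i : {mpoly K[d]}) = if (i < k)%N then 'X_i else 0.
Proof. by rewrite /truncate_vars comp_mpolyXU -tnth_nth tnth_mktuple. Qed.

Lemma truncate_varsK d k l (f : {mpoly K[d]}) : (l <= k)%N ->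
  truncate_vars l (truncate_vars k f) = truncate_vars l f.
Proof.
move=> le_lk; rewrite /truncate_vars comp_mpolyA; congr (f \mPo _).
apply: eq_mktuple => i; rewrite tnth_mktuple.
have [lt_ik|le_ki] := ltnP i k; first exact: truncate_varsX.
by rewrite comp_mpoly0 ltnNge (leq_trans le_lk).
Qed.

Section MonomialAlgebra.

Variables (e d : nat) (le_ed : (e <= d)%N).

Lemma mpoly_inclX (m : 'X_{1..e}) :
  mpoly_incl le_ed ('X_[m] : {mpoly K[e]}) = \prod_(i < e) 'X_(widen_ord le_ed i) ^+ m i.
Proof.
by rewrite /mpoly_incl comp_mpolyX; apply: eq_bigr => i _; rewrite tnth_mktuple.
Qed.

Variable G : seq 'X_{1..e}.

Let A : {mpoly K[d]} -> Prop :=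
  generated_algebra [seq mpoly_incl le_ed m | m <- monomials K G].

Lemma monomial_algebra_chain :
  (forall j : 'I_e, exists2 w, w \in G &
     (0 < w j)%N /\ forall l : 'I_e, (j < l)%N -> w l = 0%N) ->
  has_prime_chain A e.
Proof.
move=> wG; have sA : subalgebra A by exact: generated_subalgebra.
have [Ac AD AM] := sA.
exists (fun i f => A f /\ truncate_vars (e - i) f = 0); split=> [i le_ie|i lt_ie].
  split=> [f []//||a f Aa [Af f0]|[_ /eqP]|f g Af Ag [_ /eqP]].
  - split=> [|f g [Af f0] [Ag g0]]; first by rewrite -mpolyC0 /truncate_vars comp_mpolyC.
    by split; [apply: AD | rewrite /truncate_vars comp_mpolyD -/(truncate_vars _ _) f0 add0r].
  - by split; [apply: AM | rewrite /truncate_vars rmorphM /= -!/(truncate_vars _ _) f0 mulr0].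
  - by rewrite /truncate_vars comp_mpoly1 oner_eq0.
  rewrite /truncate_vars rmorphM /= mulf_eq0 => /orP[] /eqP; [by left | by right].
split=> [f [Af f0]|].
  split=> //; rewrite -(truncate_varsK _ (k := e - i)) ?leq_sub2l //.
  by rewrite f0 /truncate_vars comp_mpoly0.
(* The separating monomial has last variable of index [e - i.+1]: truncating at [e - i.+1] kills it,
   truncating at [e - i] does not. *)
have ltj : (e - i.+1 < e)%N by rewrite subnSK // leq_subr.
have [w Gw [wj w0]] := wG (Ordinal ltj); exists (mpoly_incl le_ed 'X_[w]).
have Aw : A (mpoly_incl le_ed 'X_[w]) by apply: mem_generated_algebra; rewrite !map_f.
have truncE k : truncate_vars k (mpoly_incl le_ed 'X_[w]) =
    \prod_(i < e) (if (i < k)%N then 'X_(widen_ord le_ed i) else 0) ^+ w i.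
  rewrite mpoly_inclX /truncate_vars rmorph_prod; apply: eq_bigr => x _.
  by rewrite rmorphXn /=; congr (_ ^+ _); apply: truncate_varsX.
split; first split=> //; rewrite ?truncE.
  by rewrite (bigD1 (Ordinal ltj)) //= ltnn expr0n eqn0Ngt wj mul0r.
case=> _ /eqP; apply/negP/prodf_neq0 => x _.
have [lt_x|] := ltnP x (e - i); last by rewrite -subnSK // => /w0 ->; rewrite oner_eq0.
by apply: expf_neq0; rewrite -msize_poly_eq0 msizeX.
Qed.

(** Quantifying over [j] with [j.+1 = e] names the last variable and makes the condition vacuous for
    [e = 0]. *)
Lemma krull_dim_strongly_stable :
  strongly_stable G ->
  (forall j : 'I_e, j.+1 = e -> exists2 u, u \in G & (0 < u j)%N) -> krull_dim A e.
Proof.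
move=> stG lastG; split=> [|l]; last first.
  apply: (@prime_chain_length d e (comp_mpoly [tuple 'X_(widen_ord le_ed i) | i < e])).
    exact: generated_subalgebra.
  apply: generated_algebra_min => [|_ /mapP[h _ ->]]; last by exists h.
  split=> [c|_ _ [f ->] [g ->]|_ _ [f ->] [g ->]].
  - by exists c%:MP; rewrite /= comp_mpolyC.
  - by exists (f + g); rewrite rmorphD.
  - by exists (f * g); rewrite rmorphM.
apply: monomial_algebra_chain => j; apply: (@strongly_stable_leading e G j) => //.
have ltp : (e.-1 < e)%N by rewrite prednK // (leq_ltn_trans _ (ltn_ord j)).
have [|u Gu u_pos] := lastG (Ordinal ltp); first by rewrite /= prednK // (leq_ltn_trans _ ltp).
by exists u => //; exists (Ordinal ltp) => //=; rewrite -ltnS prednK // (leq_ltn_trans _ ltp).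
Qed.

End MonomialAlgebra.

End KrullDimension.

(** * Borel sets of monomials *)

Section BorelSets.

Variables (K : fieldType) (d : nat).
Implicit Types (M N : 'M[K]_d) (m u v : 'X_{1..d}) (G : seq 'X_{1..d}).

Lemma generated_idealD (s : seq {mpoly K[d]}) f g :
  generated_ideal s f -> generated_ideal s g -> generated_ideal s (f + g).
Proof.
move=> [a ->] [b ->]; exists (fun i => a i + b i).
by rewrite -big_split; apply: eq_bigr => i _; rewrite mulrDl.
Qed.

Lemma generated_idealM (s : seq {mpoly K[d]}) f g :
  generated_ideal s g -> generated_ideal s (f * g).
Proof.
move=> [b ->]; exists (fun i => f * b i).
by rewrite mulr_sumr; apply: eq_bigr => i _; rewrite mulrA.
Qed.

Lemma generated_ideal0 (s : seq {mpoly K[d]}) : generated_ideal s 0.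
Proof. by exists (fun=> 0); rewrite big1 // => i _; rewrite mul0r. Qed.

Lemma generated_ideal_sum (s : seq {mpoly K[d]}) (I : Type) (r : seq I) (P : pred I)
    (F : I -> {mpoly K[d]}) :
  (forall i, P i -> generated_ideal s (F i)) ->
  generated_ideal s (\sum_(i <- r | P i) F i).
Proof.
move=> IF; elim/big_rec: _ => [|i x Pi]; first exact: generated_ideal0.
by apply: generated_idealD; apply: IF.
Qed.

Lemma mem_generated_ideal (s : seq {mpoly K[d]}) f : f \in s -> generated_ideal s f.
Proof.
rewrite -index_mem => lt_fs; pose i0 := Ordinal lt_fs.
exists (fun i => (i == i0)%:R); rewrite (bigD1 i0) //= eqxx mul1r big1 ?addr0.
  by rewrite (tnth_nth 0) /= nth_index // -index_mem.
by move=> i /negPf->; rewrite mul0r.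
Qed.

Lemma msupp_monomial_ideal G f m :
  generated_ideal (monomials K G) f -> m \in msupp f ->
  exists2 u, u \in G & (u <= m)%MM.
Proof.
case=> c -> /=; rewrite mcoeff_msupp raddf_sum /=.
have [/hasP[u uG le_um] _|/hasPn noG] := boolP (has (fun u => (u <= m)%MM) G).
  by exists u.
case/eqP; apply: big1 => i _; have /mapP[u uG ->] := mem_tnth i (in_tuple (monomials K G)).
apply/eqP; rewrite mcoeff_eq0; apply: contra (noG u uG).
by rewrite (perm_mem (msuppMX _ _)) => /mapP[v _ ->]; apply: lem_addr.
Qed.

Lemma linear_substX M j : linear_subst M 'X_j = \sum_i M i j *: 'X_i.
Proof. by rewrite /linear_subst comp_mpolyXU -tnth_nth tnth_mktuple. Qed.

Lemma linear_subst_mul M N f :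
  linear_subst M (linear_subst N f) = linear_subst (M *m N) f.
Proof.
rewrite /linear_subst comp_mpolyA; congr (f \mPo _); apply: eq_mktuple => j.
rewrite tnth_mktuple linear_sum /=.
under eq_bigr => i _ do rewrite linearZ /= -/(linear_subst M _) linear_substX scaler_sumr.
rewrite exchange_big; apply: eq_bigr => i _ /=; rewrite mxE scaler_suml.
by apply: eq_bigr => k _; rewrite scalerA mulrC.
Qed.

Lemma linear_subst1 (f : {mpoly K[d]}) : linear_subst 1%:M f = f.
Proof.
rewrite -[RHS]comp_mpoly_id; congr (f \mPo _); apply: eq_mktuple => j.
rewrite (bigD1 j) //= big1 ?addr0; first by rewrite mxE eqxx scale1r.
by move=> i /negPf neq_ij; rewrite mxE neq_ij scale0r.
Qed.

Lemma upper_triangularP M :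
  reflect (forall i j : 'I_d, (j < i)%N -> M i j = 0) (upper_triangular M).
Proof.
rewrite /upper_triangular; apply: (iffP is_trig_mxP) => trM i j lt_ij.
  by have := trM j i lt_ij; rewrite mxE.
by rewrite mxE trM.
Qed.

Lemma det_upper_triangular M : upper_triangular M -> \det M = \prod_i M i i.
Proof. by move/det_trig; rewrite det_tr => ->; apply: eq_bigr => i _; rewrite mxE. Qed.

(** Strong induction on the column [j]: in entry [(i, j)] of [invmx M *m M = 1], terms before [j]
    vanish by induction and terms after [j] by triangularity of [M], leaving [invmx M i j] times a
    nonzero diagonal entry. *)
Lemma upper_triangular_inv M :
  M \in unitmx -> upper_triangular M -> upper_triangular (invmx M).
Proof.
move=> uM trM; have /upper_triangularP M0 := trM; apply/upper_triangularP => i j.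
have diagM l : M l l != 0.
  move: uM; rewrite unitmxE det_upper_triangular // unitfE.
  by move/prodf_neq0/(_ l isT).
have [n] := ubnP (j : nat); elim: n j => // n IH j /ltnSE le_jn lt_ji.
have /matrixP/(_ i j) := mulVmx uM; rewrite !mxE (bigD1 j) //= big1 ?addr0.
  rewrite -val_eqE (gtn_eqF lt_ji) => /eqP.
  by rewrite mulf_eq0 (negPf (diagM j)) orbF => /eqP.
move=> k neq_kj; have [lt_kj|] := ltnP k j.
  by rewrite IH ?mul0r ?(leq_trans lt_kj le_jn) ?(ltn_trans lt_kj lt_ji).
by rewrite leq_eqVlt (inj_eq val_inj) eq_sym (negPf neq_kj) => /M0->; rewrite mulr0.
Qed.

(** Here [v] collects the factors already expanded. Expanding a factor of index [l] in [u] moves a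
    variable of index at most [l] into [v], and strong stability keeps the total exponent in [G]. *)
Lemma linear_subst_stable G M u v : strongly_stable G -> upper_triangular M ->
  (v + u)%MM \in G ->
  generated_ideal (monomials K G) ('X_[v] * linear_subst M 'X_[u]).
Proof.
move=> stG /upper_triangularP trM.
have [n] := ubnP (mdeg u); elim: n u v => // n IH u v le_un Gvu.
have [u_0|u0] := eqVneq u 0%MM.
  rewrite u_0 addm0 in Gvu; rewrite u_0 mpolyX0 /linear_subst comp_mpoly1 mulr1.
  exact/mem_generated_ideal/map_f.
have [l ul] : exists l, (0 < u l)%N.
  apply/existsP; apply: contraNT u0 => /existsPn u0; apply/eqP/mnmP => l.
  by rewrite mnm0E; apply/eqP; rewrite -leqn0 leqNgt.
have [u' uE] : exists u', u = (u' + U_(l))%MM.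
  exists (u - U_(l))%MM; rewrite submK //; apply/mnm_lepP => i.
  by rewrite mnm1E; case: eqP => // <-.
move: le_un Gvu; rewrite {}uE mdegD mdeg1 addn1 ltnS => le_un Gvu {u u0 ul}.
rewrite mpolyXD /linear_subst rmorphM /= -!/(linear_subst _ _) linear_substX.
rewrite !mulr_sumr; apply: generated_ideal_sum => i _.
rewrite -!scalerAr -mul_mpolyC [_ * 'X_i]mulrC (mulrA 'X_[v]) -mpolyXD.
have [lt_li|le_il] := ltnP l i; first by rewrite trM // mpolyC0 mul0r; exact: generated_ideal0.
apply/generated_idealM/IH => //.
move: le_il; rewrite leq_eqVlt (inj_eq val_inj) => /predU1P[->|lt_il].
  by rewrite -addmA [(U_(l) + _)%MM]addmC.
have -> : (v + U_(i) + u' = v + (u' + U_(l)) - U_(l) + U_(i))%MM.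
  by rewrite addmA addmK -!addmA [(U_(i) + _)%MM]addmC.
by apply: stG => //; rewrite !mnmDE mnm1E eqxx !addn1 addnS.
Qed.

(** One inclusion for every upper triangular matrix suffices: applied to [invmx M], it provides the
    preimages. *)
Lemma strongly_stable_borel G :
  (exists r, forall m, m \in G -> mdeg m = r) -> strongly_stable G -> borel_set K G.
Proof.
move=> homG stG; split=> // M uM trM f.
have subI N h : upper_triangular N -> generated_ideal (monomials K G) h ->
    generated_ideal (monomials K G) (linear_subst N h).
  move=> trN [c ->]; rewrite /linear_subst linear_sum; apply: generated_ideal_sum => i _ /=.
  rewrite rmorphM /=; apply: generated_idealM; rewrite -/(linear_subst _ _).
  have /mapP[u uG ->] := mem_tnth i (in_tuple (monomials K G)).
  by rewrite -[linear_subst _ _]mul1r -mpolyX0; apply: linear_subst_stable; rewrite ?add0m.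
split=> [If|[h [Ih ->]]]; last exact: subI.
exists (linear_subst (invmx M) f); split; first by apply/subI/If/upper_triangular_inv.
by rewrite linear_subst_mul mulmxV // linear_subst1.
Qed.

(** The substitution adding ['X_i] to ['X_j] and fixing the other variables sends the monomial [u]
    to a polynomial in which [w] occurs. Hence some element of [G] divides [w], and it equals [w]
    because the degrees agree. *)
Lemma borel_strongly_stable G :
  has_pchar0 K -> borel_set K G -> strongly_stable G.
Proof.
move=> charK0 [[r homG] borG] u i j uG lt_ij uj; set w := (_ + _)%MM.
have neq_ij : i != j by rewrite -val_eqE (ltn_eqF lt_ij).
pose M : 'M[K]_d := 1%:M + delta_mx i j.
have trM : upper_triangular M.
  apply/upper_triangularP => a b lt_ba; rewrite !mxE -val_eqE (gtn_eqF lt_ba) add0r.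
  case: eqP => //= ai; case: eqP => //= bj.
  by move: lt_ba; rewrite ai bj ltnNge (ltnW lt_ij).
have uM : M \in unitmx.
  rewrite unitmxE det_upper_triangular // big1 ?unitr1 // => a _; rewrite !mxE eqxx.
  by case: eqP => [->|] /=; rewrite ?(negPf neq_ij) addr0.
have MX l : linear_subst M 'X_l = 'X_l + (l == j)%:R *: 'X_i.
  rewrite linear_substX; under eq_bigr => a _ do rewrite !mxE scalerDl.
  rewrite big_split /= (bigD1 l) //= eqxx scale1r big1 ?addr0; last first.
    by move=> a /negPf->; rewrite scale0r.
  congr (_ + _); rewrite (bigD1 i) //= eqxx /= big1 ?addr0 // => a /negPf->.
  by rewrite scale0r.
have [k uj_k] : exists k, u j = k.+1 by exists (u j).-1; rewrite prednK.
pose u' : 'X_{1..d} := [multinom if l == j then 0%N else u l | l < d].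
pose v : 'X_{1..d} := (U_(j) *+ k + U_(i))%MM.
have wE : w = (u' + v)%MM.
  apply/mnmP => l; rewrite /w /v !mnmDE mnmBE mulmnE [u' l]mnmE !mnm1E [l == j]eq_sym addnA.
  by case: eqP => [<-|_] /=; rewrite ?uj_k ?mul1n ?subn1 ?subn0 ?addn0.
have substXu : linear_subst M 'X_[u] = ('X_j + 'X_i) ^+ k.+1 * 'X_[u'].
  rewrite /linear_subst comp_mpolyX (mpolyXE_id _ u') (bigD1 j) //= [in RHS](bigD1 j) //=.
  rewrite [u' j]mnmE eqxx expr0 mul1r uj_k; congr (_ * _).
    by rewrite tnth_mktuple -linear_substX MX eqxx scale1r.
  apply: eq_bigr => l neq_lj; rewrite tnth_mktuple -linear_substX MX (negPf neq_lj).
  by rewrite scale0r addr0 mnmE (negPf neq_lj).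
have w_supp : w \in msupp (linear_subst M 'X_[u]).
  rewrite mcoeff_msupp substXu wE mcoeffMX exprDn raddf_sum /=.
  (* Only the binomial term linear in ['X_i] contributes; its coefficient [k.+1] is nonzero in
     characteristic 0. *)
  have lt1k : (1 < k.+2)%N by [].
  rewrite (bigD1 (Ordinal lt1k)) //= big1 => [|a]; last first.
    rewrite -val_eqE /= => neq_a1; rewrite mcoeffMn !mpolyXn -mpolyXD mcoeffX.
    case: eqP => [/mnmP/(_ i)|_]; last by rewrite mul0rn.
    rewrite !mnmDE !mulmnE !mnm1E eqxx eq_sym (negPf neq_ij) /= !mul0n mul1n !add0n => a1.
    by rewrite a1 in neq_a1.
  rewrite addr0 bin1 subn1 /= expr1 mpolyXn -mpolyXD mcoeffMn mcoeffX eqxx.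
  by rewrite -mulr_natr mul1r (proj1 (pcharf0P K) charK0).
have Iu : generated_ideal (monomials K G) (linear_subst M 'X_[u]).
  by apply/(borG M uM trM); exists 'X_[u]; split=> //; exact/mem_generated_ideal/map_f.
have [m mG le_mw] := msupp_monomial_ideal Iu w_supp; suff <- : m = w by [].
have dw : mdeg w = mdeg m.
  rewrite (homG _ mG) -(homG _ uG) /w mdegD mdeg1 addn1.
  have: (U_(j) <= u)%MM; first by apply/mnm_lepP => l; rewrite mnm1E; case: eqP => // <-.
  by move=> le_ju; rewrite -{2}(submK le_ju) mdegD mdeg1 addn1.
move: dw; rewrite -{1}(submK le_mw) mdegD -[RHS]add0n => /addIn/eqP.
by rewrite mdeg_eq0 => /eqP wm0; rewrite -[RHS](submK le_mw) wm0 add0m.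
Qed.

End BorelSets.

(** * Maximal minors of the Jacobian matrix *)

Section Span.

Variables (K : fieldType) (d : nat).
Implicit Types (s : seq {mpoly K[d]}).

Definition in_span s (f : {mpoly K[d]}) : Prop :=
  exists c : 'I_(size s) -> K, f = \sum_i c i *: tnth (in_tuple s) i.

Lemma in_span0 s : in_span s 0.
Proof. by exists (fun=> 0); rewrite big1 // => i _; rewrite scale0r. Qed.

Lemma in_spanD s f g : in_span s f -> in_span s g -> in_span s (f + g).
Proof.
move=> [a ->] [b ->]; exists (fun i => a i + b i).
by rewrite -big_split; apply: eq_bigr => i _; rewrite scalerDl.
Qed.

Lemma in_spanZ s c f : in_span s f -> in_span s (c *: f).
Proof.
move=> [b ->]; exists (fun i => c * b i).
by rewrite scaler_sumr; apply: eq_bigr => i _; rewrite scalerA.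
Qed.

Lemma in_span_sum s (I : Type) (r : seq I) (P : pred I) (F : I -> {mpoly K[d]}) :
  (forall i, P i -> in_span s (F i)) -> in_span s (\sum_(i <- r | P i) F i).
Proof.
move=> sF; elim/big_rec: _ => [|i x Pi]; first exact: in_span0.
by apply: in_spanD; apply: sF.
Qed.

Lemma mem_in_span s f : f \in s -> in_span s f.
Proof.
rewrite -index_mem => lt_fs; pose i0 := Ordinal lt_fs.
exists (fun i => (i == i0)%:R); rewrite (bigD1 i0) //= eqxx scale1r big1 ?addr0.
  by rewrite (tnth_nth 0) /= nth_index // -index_mem.
by move=> i /negPf->; rewrite scale0r.
Qed.

Lemma in_span_generated s f : in_span s f -> generated_algebra s f.
Proof.
have sA := generated_subalgebra s; move=> [c ->]; apply: subalgebra_sum => // i _.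
by apply: subalgebraZ => //; apply: mem_generated_algebra; apply: mem_tnth.
Qed.

Lemma pihomog_dhomog (f : {mpoly K[d]}) r t : f \is r.-homog ->
  pihomog mdeg t f = if r == t then f else 0.
Proof.
by move=> fa; case: eqP => [<-|/eqP ne]; [apply: pihomog_dE | apply: (pihomog_ne0 _ fa)].
Qed.

(** Take the component of degree [t] of [P \mPo in_tuple s]: each monomial of [P] becomes
    homogeneous of degree [r * mdeg m]. *)
Lemma dhomog_generated s r t f :
  (forall g, g \in s -> g \is r.-homog) -> generated_algebra s f -> f \is t.-homog ->
  exists P : {mpoly K[size s]},
    f = \sum_(m <- msupp P | (r * mdeg m == t)%N) P@_m *: ('X_[m] \mPo in_tuple s).
Proof.
move=> sr [P fE] ft; exists P.
have homX (m : 'X_{1..size s}) : 'X_[m] \mPo in_tuple s \is (r * mdeg m).-homog.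
  rewrite comp_mpolyX mdegE big_distrr /=.
  elim/big_rec2: _ => [|i k q _ qk]; first exact: dhomog1.
  by apply: dhomogM => //; apply: dhomogMn; apply: sr; apply: mem_tnth.
rewrite -{1}(pihomog_dE ft) fE comp_mpolyEX linear_sum big_mkcond [RHS]big_mkcond /=.
apply: eq_bigr => m _; rewrite linearZ /= (pihomog_dhomog _ (homX m)).
by case: eqP => // _; rewrite scaler0.
Qed.

Lemma dvdn_dhomog_generated s r t f :
  (forall g, g \in s -> g \is r.-homog) -> generated_algebra s f ->
  f \is t.-homog -> f != 0 -> (r %| t)%N.
Proof.
move=> sr sf ft; have [P ->] := dhomog_generated sr sf ft.
apply: contraR => ndvd; rewrite big1 // => m /eqP rt.
by rewrite -rt dvdn_mulr in ndvd.
Qed.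

(** As [r] is positive, [r * mdeg m = r] leaves only the monomials of degree one, that is, the
    generators themselves. *)
Lemma dhomog_generated_span s r f :
  (0 < r)%N -> (forall g, g \in s -> g \is r.-homog) ->
  generated_algebra s f -> f \is r.-homog -> in_span s f.
Proof.
move=> r0 sr sf fr; have [P ->] := dhomog_generated sr sf fr.
apply: in_span_sum => m; rewrite -{2}[r]muln1 eqn_pmul2l // => /mdeg1P[i /eqP->].
by apply: in_spanZ; rewrite comp_mpolyXU -tnth_nth; apply/mem_in_span/mem_tnth.
Qed.

(** The Cauchy-Binet formula before grouping: [f] runs over all choices of columns, including
    unordered and repeated ones. *)
Lemma det_mul_colsub (R : comNzRingType) n k (A : 'M[R]_(k, n)) (B : 'M[R]_(n, k)) :
  \det (A *m B) = \sum_(f : {ffun 'I_k -> 'I_n}) (\prod_i B (f i) i) * \det (colsub f A).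
Proof.
rewrite -det_tr /determinant.
under eq_bigr => p _.
  under eq_bigr => i _ do rewrite !mxE.
  rewrite bigA_distr_bigA mulr_sumr; over.
rewrite exchange_big; apply: eq_bigr => f _ /=.
rewrite -/(determinant _) -det_tr mulr_sumr; apply: eq_bigr => p _.
rewrite mulrCA -big_split /=; congr (_ * _).
by apply: eq_bigr => i _; rewrite !mxE mulrC.
Qed.

(** A repeated column gives 0; otherwise sorting the columns changes only the sign. *)
Lemma maximal_minor_span n (J : 'M[{mpoly K[d]}]_(d, n)) (f : 'I_d -> 'I_n) :
  in_span (maximal_minors J) (\det (colsub f J)).
Proof.
have [/injectiveP f_inj|/injectivePn[i [j neq_ij fij]]] := boolP (injectiveb f); last first.
  rewrite -det_tr (determinant_alternate neq_ij); first exact: in_span0.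
  by move=> k; rewrite !mxE fij.
pose s := sort (relpre val leq) [tuple f i | i < d].
have /tuple_permP[p sE] : perm_eq s [tuple f i | i < d] by rewrite perm_sort.
pose c := [ffun i => f (p i)].
have c_incr : increasing c.
  apply/forallP => i; apply/forallP => j; apply/implyP => lt_ij; rewrite !ffunE.
  rewrite ltn_neqAle (inj_eq val_inj) (inj_eq f_inj) (inj_eq perm_inj).
  rewrite -val_eqE (ltn_eqF lt_ij) /=.
  have sizes : size s = d by rewrite size_sort size_tuple.
  have nths (k : 'I_d) : nth (f i) s k = f (p k) by rewrite sE -tnth_nth !tnth_mktuple.
  have s_sorted : sorted (relpre val leq) s.
    by apply: sort_sorted => x y; apply: leq_total.
  rewrite -!nths; apply: (sorted_ltn_nth _ _ s_sorted) => //; last 2 first.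
  - by rewrite inE sizes.
  - by rewrite inE sizes.
  by move=> x y z /=; apply: leq_trans.
have -> : \det (colsub f J) = (-1) ^+ p *: \det (colsub c J).
  have -> : colsub c J = col_perm p (colsub f J).
    by apply/matrixP => i j; rewrite !mxE ffunE.
  rewrite col_permE det_mulmx det_perm odd_permV.
  by case: (odd_perm p); rewrite ?expr1 ?scaleN1r ?mulrN1 ?opprK // !expr0 scale1r mulr1.
apply/in_spanZ/mem_in_span/mapP; exists c => //.
by rewrite mem_enum inE.
Qed.


(** Derivatives kill constants, so the selected columns of [jacobian s] are [jacobian t] times a
    matrix over [K], and the Cauchy-Binet expansion has scalar coefficients. *)
Lemma jacobian_minors_span s (t : seq {mpoly K[d]}) :
  (forall f, f \in s -> exists c, in_span t (f - c%:MP)) ->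
  forall h, h \in maximal_minors (jacobian s) -> in_span (maximal_minors (jacobian t)) h.
Proof.
move=> st h /mapP[f _ ->].
have /fin_all_exists[c cP] (j : 'I_d) : exists c : 'I_(size t) -> K, exists c0,
    tnth (in_tuple s) (f j) = \sum_k c k *: tnth (in_tuple t) k + c0%:MP.
  have [c0 [c cE]] := st _ (mem_tnth (f j) (in_tuple s)).
  by exists c, c0; rewrite -cE subrK.
have -> : colsub f (jacobian s) = jacobian t *m \matrix_(k, j) (c j k)%:MP.
  apply/matrixP => i j; rewrite !mxE; have [c0 ->] := cP j.
  rewrite mderivD mderivC addr0 linear_sum; apply: eq_bigr => k _.
  by rewrite !mxE linearZ /= -mul_mpolyC mulrC.
rewrite det_mul_colsub; apply: in_span_sum => g _.
rewrite (_ : \prod_i _ = (\prod_i c i (g i))%:MP); last first.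
  by rewrite rmorph_prod; apply: eq_bigr => i _; rewrite mxE.
by rewrite mul_mpolyC; apply/in_spanZ/maximal_minor_span.
Qed.

End Span.

(** * Gauss algebras of monomial algebras *)

Section GaussMonomials.

Variables (K : fieldType) (d : nat).
Implicit Types (u : 'I_d -> 'X_{1..d}) (G : seq 'X_{1..d}).

Definition log_mx u : 'M[K]_d := \matrix_(i, j) (u j i)%:R.

Definition all_ones : 'X_{1..d} := [multinom 1%N | i < d].

(** The subtraction is truncated; it is exact when [\det (log_mx u)] is nonzero, by
    [all_ones_le]. *)
Definition gauss_exponent u : 'X_{1..d} := (\sum_j u j - all_ones)%MM.

(** A variable dividing none of the [u j] would give a zero row of [log_mx u]. *)
Lemma all_ones_le u : \det (log_mx u) != 0 -> (all_ones <= \sum_j u j)%MM.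
Proof.
move=> det0; apply/mnm_lepP => i; rewrite mnmE mnm_sumE lt0n.
apply: contra det0; rewrite sum_nat_eq0 => /forallP u0.
rewrite (expand_det_row _ i) big1 // => j _; rewrite mxE.
by have /implyP/(_ isT)/eqP-> := u0 j; rewrite mul0r.
Qed.

(** Multiplying row [i] by ['X_i] turns each derivative back into ['X_[u j]] times its exponent, so
    the Jacobian becomes [log_mx u] with columns scaled by the ['X_[u j]]; then cancel the product
    of the variables. *)
Lemma det_jacobian_monomials u :
  \det (\matrix_(i, j) ('X_[u j] : {mpoly K[d]})^`M(i)) =
    \det (log_mx u) *: 'X_[gauss_exponent u].
Proof.
set J := \matrix_(i, j) _.
have X1 : \prod_i 'X_i = 'X_[all_ones] :> {mpoly K[d]}.
  by rewrite mpolyXE_id; apply: eq_bigr => i _; rewrite mnmE.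
have XX : \prod_j 'X_[u j] = 'X_[\sum_j u j] :> {mpoly K[d]}.
  by rewrite -(big_morph _ (@mpolyXD _ K) (@mpolyX0 _ K)).
have detJ : 'X_[all_ones] * \det J = \det (log_mx u) *: 'X_[\sum_j u j].
  have := congr1 determinant (_ : diag_mx (\row_i ('X_i : {mpoly K[d]})) *m J =
     map_mx (@mpolyC d K) (log_mx u) *m diag_mx (\row_j 'X_[u j])).
  rewrite !det_mulmx !det_diag det_map_mx mul_mpolyC -X1 -XX.
  under eq_bigr do rewrite mxE; move=> ->; last first.
    apply/matrixP => i j; rewrite mul_diag_mx mul_mx_diag !mxE mderivX -scalerAr.
    rewrite mul_mpolyC; have [->|u_ji] := posnP (u j i); first by rewrite !scale0r.
    congr (_ *: _); rewrite -mpolyXD addmC submK //.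
    by apply/mnm_lepP => l; rewrite mnm1E; case: eqP => // <-.
  by congr (_ *: _); apply: eq_bigr => j _; rewrite mxE.
have X1n0 : 'X_[all_ones] != 0 :> {mpoly K[d]} by rewrite -msize_poly_eq0 msizeX.
apply: (mulfI X1n0); rewrite detJ -scalerAr.
have [->|det0] := eqVneq (\det (log_mx u)) 0; first by rewrite !scale0r.
by rewrite -mpolyXD addmC submK // all_ones_le.
Qed.

(** All index functions may be allowed: reordering changes the determinant by a sign only, and a
    repeated index makes it 0. *)
Definition gauss_exponents G : seq 'X_{1..d} :=
  [seq gauss_exponent (fun j => nth 0%MM G (f j)) | f : {ffun 'I_d -> 'I_(size G)} <-
     enum [pred f : {ffun 'I_d -> 'I_(size G)} |
            \det (log_mx (fun j => nth 0%MM G (f j))) != 0]].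

Lemma gauss_exponentsP G m :
  reflect (exists2 u, (forall j, u j \in G) & \det (log_mx u) != 0 /\ m = gauss_exponent u)
          (m \in gauss_exponents G).
Proof.
apply: (iffP mapP) => [[f]|[u uG [det0 ->]]].
  rewrite mem_enum inE => det0 ->; eexists; last by split; first exact: det0.
  by move=> j; apply: mem_nth.
have lt_u j : (index (u j) G < size G)%N by rewrite index_mem.
pose f := [ffun j => Ordinal (lt_u j)].
have uE j : nth 0%MM G (f j) = u j by rewrite ffunE nth_index.
exists f; last by congr (_ - _)%MM; apply: eq_bigr => j _; rewrite uE.
rewrite mem_enum inE (_ : log_mx _ = log_mx u) //.
by apply/matrixP => i j; rewrite !mxE uE.
Qed.

Lemma generated_minors_monomials G f :
  generated_algebra (maximal_minors (jacobian (monomials K G))) f <->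
  generated_algebra (monomials K (gauss_exponents G)) f.
Proof.
have tnthG (j : 'I_(size (monomials K G))) :
    tnth (in_tuple (monomials K G)) j = 'X_[nth 0%MM G j].
  by rewrite (tnth_nth 0) /= (nth_map 0%MM) // -(size_map (fun m => 'X_[K, m])).
apply: eq_generated_algebra => {}f /mapP.
  case=> c _ ->; pose u j := nth 0%MM G (c j).
  have -> : \det (colsub c (jacobian (monomials K G))) =
      \det (log_mx u) *: 'X_[gauss_exponent u].
    rewrite -det_jacobian_monomials; congr (\det _); apply/matrixP => i j.
    by rewrite !mxE tnthG.
  have sA := generated_subalgebra (monomials K (gauss_exponents G)).
  have [->|det0] := eqVneq (\det (log_mx u)) 0.
    by rewrite scale0r -mpolyC0; case: sA.
  apply: subalgebraZ => //; apply/mem_generated_algebra/map_f/gauss_exponentsP.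
  by exists u => // j; apply: mem_nth; rewrite -(size_map (fun m => 'X_[K, m])).
case=> m /gauss_exponentsP[u uG [det0 ->]] ->; apply: in_span_generated.
rewrite -[X in in_span _ X]scale1r -(mulVf det0) -scalerA; apply: in_spanZ.
have lt_u j : (index (u j) G < size (monomials K G))%N by rewrite size_map index_mem.
rewrite -det_jacobian_monomials.
rewrite (_ : (\matrix_(i, j) _) = colsub (fun j => Ordinal (lt_u j)) (jacobian (monomials K G))).
  exact: maximal_minor_span.
by apply/matrixP => i j; rewrite !mxE tnthG /= nth_index.
Qed.

(** The Sherman-Morrison inverse is [1%:M - c *: (w *m delta_mx 0 k)] with [c] the inverse of
    [1 + w k 0]. *)
Lemma unitmx_rank1_update (w : 'cV[K]_d) k : 1 + w k 0 != 0 ->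
  1%:M + w *m delta_mx 0 k \in unitmx.
Proof.
move=> wk; set c := (1 + w k 0)^-1.
apply: (proj1 (mulmx1_unit (_ : _ *m (1%:M - c *: (w *m delta_mx 0 k)) = _))).
rewrite mulmxBr mulmx1 mulmxDl mul1mx.
have -> : (w *m delta_mx 0 k) *m (c *: (w *m delta_mx 0 k)) =
    (c * w k 0) *: (w *m delta_mx (0 : 'I_1) k).
  rewrite -scalemxAr mulmxA -[w *m _ *m w]mulmxA.
  rewrite (_ : delta_mx 0 k *m w = (w k 0)%:M) ?mul_mx_scalar -?scalemxAl ?scalerA //.
  by apply/matrixP => a b; rewrite -rowE !mxE !ord1 mulr1n.
rewrite -scalerDl (_ : c + c * w k 0 = 1) ?scale1r ?addrK //.
by rewrite -{1}[c]mulr1 -mulrDr mulVf.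
Qed.

(* Replacing a factor u k, divisible by x_j, by x_i (u k / x_j) multiplies the
   determinant by 1 + w k, where w solves log_mx u * w = e_i - e_j. If every such
   k had w k = -1, the j-th equation would give \sum_k u k j = 1. *)
Lemma strongly_stable_gauss G : has_pchar0 K ->
  strongly_stable G -> strongly_stable (gauss_exponents G).
Proof.
move=> charK0 stG _ i j /gauss_exponentsP[u uG [det0 ->]] lt_ij.
have := all_ones_le det0 => /mnm_lepP ones_le.
rewrite mnmBE mnm_sumE mnmE subn_gt0 => sum_gt1.
have uL : log_mx u \in unitmx by rewrite unitmxE unitfE.
pose w := invmx (log_mx u) *m (delta_mx i 0 - delta_mx j 0 : 'cV[K]_d).
have Lw : log_mx u *m w = delta_mx i 0 - delta_mx j 0 by rewrite mulKVmx.
have neq_ij : i != j by rewrite -val_eqE (ltn_eqF lt_ij).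
have [k [ukj wk]] : exists k, (0 < u k j)%N /\ 1 + w k 0 != 0.
  case: (pickP [pred k | (0 < u k j)%N && (1 + w k 0 != 0)]) => [k /andP[]|no_k].
    by exists k.
  have /matrixP/(_ j 0) := Lw; rewrite !mxE !eqxx eq_sym (negPf neq_ij) /= sub0r.
  under eq_bigr => k _.
    rewrite mxE (_ : _ * _ = - (u k j)%:R); first over.
    have [->|ukj] := posnP (u k j); first by rewrite mul0r oppr0.
    have := no_k k; rewrite /= ukj => /negbFE; rewrite addrC addr_eq0 => /eqP->.
    by rewrite mulrN1.
  (* In characteristic 0 the equation holds between natural numbers, against [sum_gt1]. *)
  rewrite sumrN -natr_sum => /oppr_inj/eqP; rewrite -subr_eq0 -natrB 1?ltnW //.
  by rewrite (proj1 (pcharf0P K) charK0) subn_eq0 leqNgt sum_gt1.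
pose u' l := if l == k then (u k - U_(j) + U_(i))%MM else u l.
(* The rank-one factor adds [log_mx u *m w], the difference of two unit vectors, to column [k]
   only. *)
have Lu' : log_mx u' = log_mx u *m (1%:M + w *m delta_mx 0 k).
  rewrite mulmxDr mulmx1 mulmxA Lw; apply/matrixP => a b; rewrite !mxE big_ord1 !mxE /= /u'.
  case: eqP => [->|_]; last by rewrite mulr0 addr0.
  rewrite mulr1 mnmDE mnmBE !mnm1E !andbT natrD natrB; last by case: eqP => // <-.
  by rewrite [_ == i]eq_sym [_ == j]eq_sym -addrA [- _ + _]addrC addrA.
apply/gauss_exponentsP; exists u'.
  by move=> l; rewrite /u'; case: eqP => // _; apply: stG.
split.
  rewrite Lu' det_mulmx mulf_neq0 //.
  by have := unitmx_rank1_update wk; rewrite unitmxE unitfE.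
apply/mnmP => a; have := ones_le a; rewrite !mnmDE !mnmBE !mnm_sumE mnmE !mnm1E.
rewrite (bigD1 k) //= [in RHS](bigD1 k) //= (_ : u' k = u k - U_(j) + U_(i))%MM; last first.
  by rewrite /u' eqxx.
have -> : (\sum_(l < d | l != k) u' l a = \sum_(l < d | l != k) u l a)%N.
  by apply: eq_bigr => l /negPf; rewrite /u' => ->.
rewrite mnmDE mnmBE !mnm1E; set S := (\sum_(l < d | _) _)%N => le1.
have : ((j == a) <= u k a)%N by case: eqP => // <-.
(* Truncated subtraction is harmless at [j]: the total exponent there exceeds 1, so one unit remains
   after dividing by the product of all variables. *)
have : j = a -> (1 < \sum_l u l a)%N by move=> <-.
rewrite (bigD1 k) //= -/S; case: eqP => [ja /(_ ja)|_ _] /=; lia.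
Qed.

Lemma gauss_exponents_homog G r : (forall m, m \in G -> mdeg m = r) ->
  forall m, m \in gauss_exponents G -> mdeg m = (d * r - d)%N.
Proof.
move=> homG m /gauss_exponentsP[u uG [det0 ->]].
have ones : mdeg all_ones = d.
  by rewrite mdegE; under eq_bigr do rewrite mnmE; rewrite sum1_card card_ord.
have : mdeg (\sum_j u j)%MM = (d * r)%N.
  rewrite mdeg_sum; under eq_bigr do rewrite homG //.
  by rewrite sum_nat_const card_ord.
by rewrite -{1}(submK (all_ones_le det0)) mdegD ones => <-; rewrite addnK.
Qed.

End GaussMonomials.

(** * Removing the variables that do not occur *)

Section Restriction.

Variables (K : fieldType) (e d : nat) (le_ed : (e <= d)%N).
Implicit Types (m : 'X_{1..d}) (G : seq 'X_{1..d}).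

Definition restrict_mnm m : 'X_{1..e} := [multinom m (widen_ord le_ed i) | i < e].

Lemma mdeg_restrict_mnm m : (forall i : 'I_d, (e <= i)%N -> m i = 0%N) ->
  mdeg (restrict_mnm m) = mdeg m.
Proof.
move=> m0; rewrite !mdegE; under eq_bigr do rewrite mnmE.
rewrite -(big_ord_narrow le_ed (F := m)) big_mkcond; apply: eq_bigr => i _.
by case: ltnP => // /m0.
Qed.

Lemma mpoly_incl_restrict m : (forall i : 'I_d, (e <= i)%N -> m i = 0%N) ->
  mpoly_incl le_ed ('X_[restrict_mnm m] : {mpoly K[e]}) = 'X_[m].
Proof.
move=> m0; rewrite mpoly_inclX mpolyXE_id; under eq_bigr do rewrite mnmE.
rewrite -(big_ord_narrow le_ed (F := fun i => 'X_i ^+ m i)) big_mkcond.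
by apply: eq_bigr => i _; case: ltnP => // /m0->.
Qed.

Lemma strongly_stable_restrict G :
  strongly_stable G -> strongly_stable (map restrict_mnm G).
Proof.
move=> stG _ i j /mapP[m mG ->] lt_ij; rewrite mnmE => mj.
apply/mapP; exists (m - U_(widen_ord le_ed j) + U_(widen_ord le_ed i))%MM; first exact: stG.
by apply/mnmP => l; rewrite !(mnmE, mnmDE, mnmBE).
Qed.

End Restriction.

(** * Borel-fixed algebras from strongly stable sets, and change of generators *)

Section Transport.

Variables (K : fieldType) (d : nat).
Implicit Types A B : {mpoly K[d]} -> Prop.

Lemma eq_prime_ideal_of A B P : (forall f, A f <-> B f) ->
  prime_ideal_of A P -> prime_ideal_of B P.
Proof.
move=> AB [PA P0 PM P1 primeP]; split=> // [f /PA/AB //|a f /AB|f g /AB Af /AB].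
  exact: PM.
exact: primeP.
Qed.

Lemma eq_krull_dim A B n : (forall f, A f <-> B f) -> krull_dim A n -> krull_dim B n.
Proof.
have chainS A' B' l : (forall f, A' f <-> B' f) -> has_prime_chain A' l -> has_prime_chain B' l.
  move=> AB [P [primeP chainP]]; exists P; split=> // i /primeP.
  exact: eq_prime_ideal_of.
move=> AB [chainA maxA]; split=> [|l chainB]; first exact: chainS chainA.
by apply: maxA; apply: chainS chainB => f; split=> /AB.
Qed.

Lemma krull_dim_uniq A m n : krull_dim A m -> krull_dim A n -> m = n.
Proof. by move=> [cm maxm] [cn maxn]; apply/eqP; rewrite eqn_leq maxn ?maxm. Qed.

Lemma borel_fixed_strongly_stable B (H : seq 'X_{1..d}) :
  (exists r, forall m, m \in H -> mdeg m = r) -> strongly_stable H ->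
  (forall f, B f <-> generated_algebra (monomials K H) f) -> borel_fixed_algebra B.
Proof.
move=> [r homH] stH BE.
(* The least [e] with [p e] cuts the ring right after the last variable that occurs in [H]; this is
   the dimension. *)
pose p e := all (fun m : 'X_{1..d} => [forall i : 'I_d, (e <= i)%N ==> (m i == 0%N)]) H.
have exp : exists e, p e.
  by exists d; apply/allP => m _; apply/forallP => i; rewrite leqNgt ltn_ord.
have pP e : reflect (forall m, m \in H -> forall i : 'I_d, (e <= i)%N -> m i = 0%N) (p e).
  apply: (iffP allP) => [pe m /pe/forallP m0 i le_ei|m0 m mH].
    by have /implyP/(_ le_ei)/eqP := m0 i.
  by apply/forallP => i; apply/implyP => le_ei; apply/eqP/m0.
case: (ex_minnP exp) => e /pP e0 e_min.
have le_ed : (e <= d)%N.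
  by apply: e_min; apply/pP => m _ i; rewrite leqNgt ltn_ord.
exists e, le_ed, (map (restrict_mnm le_ed) H).
have stR : strongly_stable (map (restrict_mnm le_ed) H) by apply: strongly_stable_restrict.
have inclE : [seq mpoly_incl le_ed m | m <- monomials K (map (restrict_mnm le_ed) H)] =
    monomials K H.
  rewrite /monomials -!map_comp; apply/eq_in_map => m mH /=.
  by apply/mpoly_incl_restrict/e0.
split.
- apply: strongly_stable_borel => //; exists r => _ /mapP[m mH ->].
  by rewrite mdeg_restrict_mnm ?homH //; apply: e0.
- by move=> f; rewrite inclE.
apply: (@eq_krull_dim (generated_algebra
  [seq mpoly_incl le_ed m | m <- monomials K (map (restrict_mnm le_ed) H)])).
  by move=> f; rewrite inclE; split=> /BE.
apply: krull_dim_strongly_stable => // j je.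
(* By minimality of [e] some element of [H] involves a variable of index at least [j]; since
   [j.+1 = e], that variable is [j]. *)
have npj : ~~ p j by apply/negP => /e_min; rewrite -{1}je ltnn.
have /allPn[m mH /forallPn[i]] := npj; rewrite negb_imply => /andP[le_ji mi].
exists (restrict_mnm le_ed m); first exact: map_f.
rewrite mnmE lt0n; move: le_ji; rewrite leq_eqVlt => /predU1P[ji|lt_ji].
  by rewrite (_ : widen_ord le_ed j = i) //; apply: val_inj.
by rewrite e0 // -je in mi.
Qed.

(** The two degrees divide each other, hence agree, and each generator is then a linear combination
    of the generators in the other system. The constants [c] absorb the case where [s] is empty and
    [t] consists of constants. *)
Lemma gauss_generators_span (s t : seq {mpoly K[d]}) r :
  (0 < r)%N -> (forall f, f \in s -> f != 0 /\ f \is r.-homog) ->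
  (exists r', forall f, f \in t -> f != 0 /\ f \is r'.-homog) ->
  (forall f, generated_algebra s f <-> generated_algebra t f) ->
  (forall f, f \in s -> exists c, in_span t (f - c%:MP)) /\
  (forall f, f \in t -> exists c, in_span s (f - c%:MP)).
Proof.
move=> r_gt0 s_hom [r' t_hom] st.
have sr f : f \in s -> f \is r.-homog by case/s_hom.
have tr f : f \in t -> f \is r'.-homog by case/t_hom.
have sub_s f : f \in s -> generated_algebra t f.
  by move=> fs; apply/st/mem_generated_algebra.
have sub_t f : f \in t -> generated_algebra s f.
  by move=> ft; apply/st/mem_generated_algebra.
have [s0|] := posnP (size s).
  rewrite (size0nil s0) in sub_t *; split=> // f /sub_t[P ->].
  exists P@_0%MM; rewrite -{1}(mpolyKC P) comp_mpolyC subrr; exact: in_span0.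
rewrite -has_predT => /hasP[f0 f0s _].
have [f00 f0r] := s_hom _ f0s.
have dvd_r : (r' %| r)%N := dvdn_dhomog_generated tr (sub_s _ f0s) f0r f00.
(* An empty [t] is vacuously homogeneous of degree 0, which would force 0 to divide [r]. *)
have [t0|] := posnP (size t).
  have: (0 %| r)%N.
    apply: (dvdn_dhomog_generated _ (sub_s _ f0s)) => //.
    by rewrite (size0nil t0).
  by rewrite dvd0n => /eqP r0; rewrite r0 in r_gt0.
rewrite -has_predT => /hasP[g0 g0t _].
have [g00 g0r] := t_hom _ g0t.
have := dvdn_dhomog_generated sr (sub_t _ g0t) g0r g00.
move=> dvd_r'; have rE : r = r' by apply/eqP; rewrite eqn_dvd dvd_r' dvd_r.
rewrite -{}rE in tr.
split=> f f_in; exists 0; rewrite mpolyC0 subr0; apply: (@dhomog_generated_span _ _ _ r) => //.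
- exact: sub_s.
- exact: sr.
- exact: sub_t.
- exact: tr.
Qed.

End Transport.

Theorem theorem2p2 (K : fieldType) (charK0 : has_pchar0 K) (d : nat)
    (A B : {mpoly K[d]} -> Prop) :
  borel_fixed_algebra A -> is_gauss_algebra A B -> borel_fixed_algebra B.
Proof.
move=> [e [le_ed [G [borG AG dimAe]]]] [r [g [r_gt0 g_hom Ag dimAd BE]]].
(* Both definitions fix the dimension of [A], so the Borel set uses all [d] variables and the
   inclusion is the identity. *)
have ed := krull_dim_uniq dimAe dimAd; case: d / ed => //
  in A B le_ed AG dimAe g g_hom Ag dimAd BE *.
have stG := borel_strongly_stable charK0 borG; have [[r' homG] _] := borG.
have inclE : [seq mpoly_incl le_ed m | m <- monomials K G] = monomials K G.
  rewrite -[RHS]map_id; apply: eq_map => m; rewrite -[RHS]comp_mpoly_id.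
  by congr (m \mPo _); apply: eq_mktuple => i; congr 'X_ _; apply: val_inj.
rewrite inclE in AG.
have [g_span G_span] : (forall f, f \in g -> exists c, in_span (monomials K G) (f - c%:MP)) /\
    (forall f, f \in monomials K G -> exists c, in_span g (f - c%:MP)).
  apply: (gauss_generators_span r_gt0) => //.
    exists r' => _ /mapP[m mG ->]; rewrite -msize_poly_eq0 msizeX dhomogX.
    by split=> //; apply/eqP/homG.
  by move=> f; split=> [/Ag/AG|/AG/Ag].
apply: (@borel_fixed_strongly_stable _ _ _ (gauss_exponents K G)).
- by exists (e * r' - e)%N; apply: gauss_exponents_homog.
- exact: strongly_stable_gauss.
(* Replace [g] by the monomials of [G]: each family of minors lies in the span of the other. *)
move=> f; apply: iff_trans (BE f) _; apply: iff_trans _ (generated_minors_monomials _ _).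
by apply: eq_generated_algebra => {}f f_in; apply: in_span_generated;
  apply: jacobian_minors_span f_in.
Qed.
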